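(* Let $\Pi$ and $G$ be groups and let $\psi:\Pi\to\operatorname{Aut}G/\operatorname{In}G$ be a group homomorphism. There exists a bijection $$\Delta:\operatorname{Hom}_\psi[\operatorname{Dis}\Pi,\mathbf{Aut}_G]\to\operatorname{Ext}_\psi(\Pi,G).$$
   Context: The operation of $G$ is written additively (though $G$ need not be abelian); $\operatorname{In}G$ is the group of inner automorphisms, $\mu_c(a)=c+a-c$, and $ZG$ is the center. A Gr-category is a monoidal category in which every object is invertible and every morphism is an isomorphism; Gr-functors are monoidal functors $(F,\widetilde F,F_* )$ between Gr-categories, with $\widetilde F_{X,Y}:FX\otimes FY\to F(X\otimes Y)$ and $F_*:I'\to FI$. A homotopy $\alpha:(F,\widetilde F,F_* )\to(K,\widetilde K,K_* )$ is a natural isomorphism $\alpha:F\to K$ with $K_*=\alpha_I\circ F_*$ and $\alpha_{X\otimes Y}\circ\widetilde F_{X,Y}=\widetilde K_{X,Y}\circ(\alpha_X\otimes\alpha_Y)$. $\operatorname{Dis}\Pi$ is the strict Gr-category whose objects are the elements of $\Pi$, whose only morphisms are identities, and whose tensor product is the multiplication of $\Pi$. $\mathbf{Aut}_G$ is the strict Gr-category whose objects are the elements of $\operatorname{Aut}G$, with $\operatorname{Hom}(\alpha,\beta)=\{c\in G\mid\alpha=\mu_c\circ\beta\}$; the composite of $c:\alpha\to\beta$ and $d:\beta\to\gamma$ is $d\circ c=c+d$ (sum in $G$); $\alpha\otimes\beta=\alpha\circ\beta$, and for $c:\alpha\to\alpha'$, $d:\beta\to\beta'$, $c\otimes d=c+\alpha'(d):\alpha\otimes\beta\to\alpha'\otimes\beta'$.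 The group $\pi_0(\mathbf{Aut}_G)$ of isomorphism classes of objects is $\operatorname{Aut}G/\operatorname{In}G$ and $\pi_1(\mathbf{Aut}_G)=\operatorname{Aut}(\mathrm{id}_G)=ZG$. $\operatorname{Hom}_\psi[\operatorname{Dis}\Pi,\mathbf{Aut}_G]$ is the set of homotopy classes of Gr-functors $F:\operatorname{Dis}\Pi\to\mathbf{Aut}_G$ inducing the pair of homomorphisms $(\psi,0)$ on $(\pi_0,\pi_1)$, i.e. such that the class of $F(x)$ in $\operatorname{Aut}G/\operatorname{In}G$ is $\psi(x)$ for every $x\in\Pi$. $\operatorname{Ext}_\psi(\Pi,G)$ is the set of equivalence (congruence) classes of group extensions $0\to G\to B\to\Pi\to1$ such that the induced homomorphism $\Pi\to\operatorname{Aut}G/\operatorname{In}G$ given by conjugation in $B$ is $\psi$; two extensions are congruent if there is an isomorphism of the middle groups inducing the identity on $G$ and on $\Pi$. *)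

(* Defs.v *)
From HB Require Import structures.
From mathcomp Require Import all_boot.
From mathcomp Require Import boolp.

Set Implicit Arguments.
Unset Strict Implicit.
Unset Printing Implicit Defensive.

Local Open Scope group_scope.
Local Open Scope quotient_scope.

(* Groups are possibly infinite [groupType]s; G need not be abelian and its    *)
(* law, usually written additively in this context, is written                *)
(* multiplicatively.                                                          *)

Lemma multiplicative1 (H K : groupType) (f : {multiplicative H -> K}) : f 1 = 1.
Proof. by apply: (mulgI (f 1)); rewrite -gmulfM !mulg1. Qed.

Record aut (G : groupType) := Aut {
  aut_fun :> G -> G;
  autM : {morph aut_fun : a b / a * b};
  aut_bij : bijective aut_fun }.

Section AutGroup.
Variable G : groupType.
Implicit Types s t u : aut G.

Lemma aut_ext s t : s =1 t -> s = t.
Proof.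
case: s t => [f fM fB] [g gM gB] /= /funext fg.
by case: g / fg gM gB => gM gB; congr Aut; apply: Prop_irrelevance.
Qed.

HB.instance Definition _ := gen_eqMixin (aut G).
HB.instance Definition _ := gen_choiceMixin (aut G).

Definition aut_one : aut G :=
  @Aut G id (fun _ _ => erefl) (Bijective (frefl id) (frefl id)).

Lemma aut_mul_morph s t : {morph s \o t : a b / a * b}.
Proof. by move=> a b /=; rewrite !autM. Qed.

Definition aut_mul s t : aut G :=
  Aut (aut_mul_morph s t) (bij_comp (aut_bij s) (aut_bij t)).

Lemma aut_inv_ex s : exists t, cancel s t /\ cancel t s.
Proof.
case: (aut_bij s) => g sK gK.
have gM : {morph g : a b / a * b}.
  by move=> a b; rewrite -{1}[a]gK -{1}[b]gK -autM sK.
by exists (Aut gM (Bijective gK sK)).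
Qed.

Definition aut_inv s : aut G := sval (cid (aut_inv_ex s)).

Lemma aut_invK s : cancel s (aut_inv s).
Proof. by rewrite /aut_inv; case: cid => t []. Qed.

Lemma aut_invVK s : cancel (aut_inv s) s.
Proof. by rewrite /aut_inv; case: cid => t []. Qed.

Lemma aut_mulA : associative aut_mul.
Proof. by move=> s t u; apply: aut_ext. Qed.

Lemma aut_mul1 : left_id aut_one aut_mul.
Proof. by move=> s; apply: aut_ext. Qed.

Lemma aut_mulr1 : right_id aut_one aut_mul.
Proof. by move=> s; apply: aut_ext. Qed.

Lemma aut_mulV : left_inverse aut_one aut_inv aut_mul.
Proof. by move=> s; apply: aut_ext => a /=; rewrite aut_invK. Qed.

Lemma aut_mulrV : right_inverse aut_one aut_inv aut_mul.
Proof. by move=> s; apply: aut_ext => a /=; rewrite aut_invVK. Qed.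

HB.instance Definition _ := isGroup.Build (aut G)
  aut_mulA aut_mul1 aut_mulr1 aut_mulV aut_mulrV.

Lemma aut_mulE s t a : (s * t) a = s (t a). Proof. by []. Qed.
Lemma aut_oneE a : (1 : aut G) a = a. Proof. by []. Qed.
Lemma aut1 s : s 1 = 1.
Proof. by apply: (mulgI (s 1)); rewrite -autM !mulg1. Qed.
Lemma autV s a : s a^-1 = (s a)^-1.
Proof. by apply: (mulgI (s a)); rewrite -autM !mulgV aut1. Qed.

Lemma inner_morph (c : G) : {morph (fun a : G => c * a * c^-1) : a b / a * b}.
Proof. by move=> a b; rewrite !mulgA mulgVK. Qed.

Lemma inner_bij (c : G) : bijective (fun a : G => c * a * c^-1).
Proof.
exists (fun a => c^-1 * a * c) => a; rewrite !mulgA.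
  by rewrite mulVg mul1g mulgVK.
by rewrite mulgV mul1g mulgK.
Qed.

Definition inner c : aut G := Aut (inner_morph c) (inner_bij c).

Lemma innerM c d : inner (c * d) = inner c * inner d.
Proof. by apply: aut_ext => a /=; rewrite invgM !mulgA. Qed.

Lemma inner1 : inner 1 = 1.
Proof. by apply: aut_ext => a /=; rewrite invg1 mulg1 mul1g. Qed.

Lemma innerV c : inner c^-1 = (inner c)^-1.
Proof. by apply: (mulgI (inner c)); rewrite -innerM !mulgV inner1. Qed.

Lemma aut_inner s c : s * inner c = inner (s c) * s.
Proof. by apply: aut_ext => a; rewrite !aut_mulE /= !autM autV. Qed.

Definition inn_rel s t : bool := `[< exists c, s = inner c * t >].

Lemma inn_relxx : reflexive inn_rel.
Proof. by move=> s; apply/asboolP; exists 1; rewrite inner1 mul1g. Qed.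

Lemma inn_rel_impl s t : inn_rel s t -> inn_rel t s.
Proof.
by move=> /asboolP[c ->]; apply/asboolP; exists c^-1; rewrite innerV mulKg.
Qed.

Lemma inn_rel_sym : symmetric inn_rel.
Proof. by move=> s t; apply/idP/idP; apply: inn_rel_impl. Qed.

Lemma inn_rel_trans : transitive inn_rel.
Proof.
move=> t s u /asboolP[c ->] /asboolP[d ->]; apply/asboolP.
by exists (c * d); rewrite innerM mulgA.
Qed.

Canonical inn_equiv := EquivRel inn_rel inn_relxx inn_rel_sym inn_rel_trans.

Definition Out : Type := {eq_quot inn_equiv}.
HB.instance Definition _ : Choice Out := Choice.on Out.
HB.instance Definition _ : EqQuotient (aut G) inn_equiv Out :=
  EqQuotient.on Out.

Definition out_class s : Out := \pi_Out s.

Lemma out_classP s t :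
  out_class s = out_class t <-> exists c, s = inner c * t.
Proof.
split=> [/eqP|st]; first by rewrite /out_class piE => /asboolP.
by apply/eqP; rewrite /out_class piE; apply/asboolP.
Qed.

Definition out_mul (A B : Out) : Out := out_class (repr A * repr B).
Definition out_inv (A : Out) : Out := out_class (repr A)^-1.

Lemma out_classK A : out_class (repr A) = A.
Proof. exact: reprK. Qed.

Lemma out_class_mul s t : out_class (s * t) = out_mul (out_class s) (out_class t).
Proof.
rewrite /out_mul; have /out_classP[c ->] := out_classK (out_class s).
have /out_classP[d ->] := out_classK (out_class t).
apply/esym/out_classP; exists (c * s d).
by rewrite innerM -!mulgA; congr (_ * _); rewrite !mulgA aut_inner.
Qed.

Lemma out_class_inv s : out_class s^-1 = out_inv (out_class s).
Proof.
rewrite /out_inv; have /out_classP[c ->] := out_classK (out_class s).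
apply/esym/out_classP; exists (s^-1 c^-1).
by rewrite invgM -innerV aut_inner.
Qed.

Lemma out_mulA : associative out_mul.
Proof.
move=> A B C; rewrite -(out_classK A) -(out_classK B) -(out_classK C).
by rewrite -!out_class_mul mulgA.
Qed.

Lemma out_mul1 : left_id (out_class 1) out_mul.
Proof. by move=> A; rewrite -(out_classK A) -out_class_mul mul1g. Qed.

Lemma out_mulr1 : right_id (out_class 1) out_mul.
Proof. by move=> A; rewrite -(out_classK A) -out_class_mul mulg1. Qed.

Lemma out_mulV : left_inverse (out_class 1) out_inv out_mul.
Proof.
by move=> A; rewrite -(out_classK A) -out_class_inv -out_class_mul mulVg.
Qed.

Lemma out_mulrV : right_inverse (out_class 1) out_inv out_mul.
Proof.
by move=> A; rewrite -(out_classK A) -out_class_inv -out_class_mul mulgV.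
Qed.

HB.instance Definition _ := isGroup.Build Out
  out_mulA out_mul1 out_mulr1 out_mulV out_mulrV.

HB.instance Definition _ :=
  isGroupMorphism.Build (aut G) Out out_class
    (fun s t => etrans (out_class_mul s t^-1)
                  (congr1 (out_mul (out_class s)) (out_class_inv t))).

End AutGroup.

Record category := Category {
  obj :> Type;
  hom : obj -> obj -> Type;
  idm : forall X, hom X X;
  comp : forall X Y Z, hom Y Z -> hom X Y -> hom X Z;
  compA : forall X Y Z T (h : hom Z T) (g : hom Y Z) (f : hom X Y),
    comp h (comp g f) = comp (comp h g) f;
  comp1m : forall X Y (f : hom X Y), comp (idm Y) f = f;
  compm1 : forall X Y (f : hom X Y), comp f (idm X) = f }.

Arguments hom {c} X Y.
Arguments idm {c} X.
Arguments comp {c X Y Z} g f.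

Notation "g \oc f" := (comp g f) (at level 50, left associativity).

Definition is_iso (C : category) (X Y : C) (f : hom X Y) : Prop :=
  exists g : hom Y X, g \oc f = idm X /\ f \oc g = idm Y.

Record monoidal_category := MonoidalCategory {
  moncat :> category;
  unit_obj : moncat;
  tensor : moncat -> moncat -> moncat;
  tensorm : forall X X' Y Y' : moncat,
    hom X X' -> hom Y Y' -> hom (tensor X Y) (tensor X' Y');
  assoc : forall X Y Z : moncat,
    hom (tensor X (tensor Y Z)) (tensor (tensor X Y) Z);
  lunit : forall X : moncat, hom (tensor unit_obj X) X;
  runit : forall X : moncat, hom (tensor X unit_obj) X;
  tensorm1 : forall X Y : moncat, tensorm (idm X) (idm Y) = idm (tensor X Y);
  tensorm_comp : forall (X X' X'' Y Y' Y'' : moncat)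
      (f' : hom X' X'') (f : hom X X') (g' : hom Y' Y'') (g : hom Y Y'),
    tensorm (f' \oc f) (g' \oc g) = tensorm f' g' \oc tensorm f g;
  assoc_iso : forall X Y Z, is_iso (assoc X Y Z);
  lunit_iso : forall X, is_iso (lunit X);
  runit_iso : forall X, is_iso (runit X);
  assoc_nat : forall (X X' Y Y' Z Z' : moncat)
      (f : hom X X') (g : hom Y Y') (h : hom Z Z'),
    assoc X' Y' Z' \oc tensorm f (tensorm g h)
      = tensorm (tensorm f g) h \oc assoc X Y Z;
  lunit_nat : forall (X Y : moncat) (f : hom X Y),
    lunit Y \oc tensorm (idm unit_obj) f = f \oc lunit X;
  runit_nat : forall (X Y : moncat) (f : hom X Y),
    runit Y \oc tensorm f (idm unit_obj) = f \oc runit X;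
  pentagon : forall X Y Z T : moncat,
    assoc (tensor X Y) Z T \oc assoc X Y (tensor Z T)
      = tensorm (assoc X Y Z) (idm T) \oc assoc X (tensor Y Z) T
          \oc tensorm (idm X) (assoc Y Z T);
  triangle : forall X Y : moncat,
    tensorm (runit X) (idm Y) \oc assoc X unit_obj Y
      = tensorm (idm X) (lunit Y) }.

Arguments unit_obj {m}.
Arguments tensor {m} X Y.
Arguments tensorm {m X X' Y Y'} f g.
Arguments assoc {m} X Y Z.
Arguments lunit {m} X.
Arguments runit {m} X.

Notation "X \ox Y" := (tensor X Y) (at level 40, left associativity).
Notation "f \oxm g" := (tensorm f g) (at level 40, left associativity).

Record gr_category := GrCategory {
  grcat :> monoidal_category;
  gr_hom_iso : forall (X Y : grcat) (f : hom X Y), is_iso f;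
  gr_obj_inv : forall X : grcat, exists Y : grcat,
    (exists f : hom (X \ox Y) unit_obj, is_iso f) /\
    (exists f : hom (Y \ox X) unit_obj, is_iso f) }.

Record functor (C D : category) := Functor {
  fobj :> C -> D;
  fmap : forall X Y : C, hom X Y -> hom (fobj X) (fobj Y);
  fmap1 : forall X : C, fmap (idm X) = idm (fobj X);
  fmap_comp : forall (X Y Z : C) (g : hom Y Z) (f : hom X Y),
    fmap (g \oc f) = fmap g \oc fmap f }.

Arguments fmap {C D} f0 {X Y} f.

(* [fmul_iso] and [funit_iso] are automatic when D is a Gr-category.          *)
Record monoidal_functor (C D : monoidal_category) := MonoidalFunctor {
  monfun :> functor C D;
  fmul : forall X Y : C, hom (monfun X \ox monfun Y) (monfun (X \ox Y));
  funit : hom unit_obj (monfun unit_obj);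
  fmul_iso : forall X Y, is_iso (fmul X Y);
  funit_iso : is_iso funit;
  fmul_nat : forall (X X' Y Y' : C) (f : hom X X') (g : hom Y Y'),
    fmul X' Y' \oc (fmap monfun f \oxm fmap monfun g)
      = fmap monfun (f \oxm g) \oc fmul X Y;
  fmul_assoc : forall X Y Z : C,
    fmap monfun (assoc X Y Z) \oc fmul X (Y \ox Z)
        \oc (idm (monfun X) \oxm fmul Y Z)
      = fmul (X \ox Y) Z \oc (fmul X Y \oxm idm (monfun Z))
        \oc assoc (monfun X) (monfun Y) (monfun Z);
  fmul_lunit : forall X : C,
    fmap monfun (lunit X) \oc fmul unit_obj X \oc (funit \oxm idm (monfun X))
      = lunit (monfun X);
  fmul_runit : forall X : C,
    fmap monfun (runit X) \oc fmul X unit_obj \oc (idm (monfun X) \oxm funit)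
      = runit (monfun X) }.

Arguments fmul {C D} m X Y.
Arguments funit {C D} m.

Definition gr_functor (C D : gr_category) := monoidal_functor C D.

Record homotopy (C D : gr_category) (F K : gr_functor C D) := Homotopy {
  hcomp :> forall X : C, hom (F X) (K X);
  hcomp_iso : forall X, is_iso (hcomp X);
  hcomp_nat : forall (X Y : C) (f : hom X Y),
    hcomp Y \oc fmap F f = fmap K f \oc hcomp X;
  hcomp_unit : funit K = hcomp unit_obj \oc funit F;
  hcomp_mul : forall X Y : C,
    hcomp (X \ox Y) \oc fmul F X Y = fmul K X Y \oc (hcomp X \oxm hcomp Y) }.

Definition homotopic (C D : gr_category) (F K : gr_functor C D) : Prop :=
  inhabited (homotopy F K).

Section HomotopicEquiv.
Variables C D : gr_category.
Implicit Types F K L : gr_functor C D.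

Lemma homotopic_refl F : homotopic F F.
Proof.
constructor; apply: (@Homotopy _ _ F F (fun X => idm (F X))).
- by move=> X; exists (idm _); rewrite comp1m.
- by move=> X Y f; rewrite comp1m compm1.
- by rewrite comp1m.
- by move=> X Y; rewrite comp1m tensorm1 compm1.
Qed.

Lemma homotopic_sym F K : homotopic F K -> homotopic K F.
Proof.
move=> [h]; pose g X := sval (cid (hcomp_iso h X)).
have gh X : g X \oc h X = idm (F X) by rewrite /g; case: cid => ? [].
have hg X : h X \oc g X = idm (K X) by rewrite /g; case: cid => ? [].
constructor; apply: (@Homotopy _ _ K F g).
- by move=> X; exists (h X).
- move=> X Y f; rewrite -[LHS]compm1 -(hg X) compA -(compA (g Y)).
  by rewrite -hcomp_nat compA gh comp1m.
- by rewrite (hcomp_unit h) compA gh comp1m.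
- move=> X Y; rewrite -[LHS]compm1 -tensorm1 -!hg tensorm_comp compA.
  by rewrite -(compA (g _)) -hcomp_mul compA gh comp1m.
Qed.

Lemma homotopic_trans F K L : homotopic F K -> homotopic K L -> homotopic F L.
Proof.
move=> [h] [k]; constructor.
apply: (@Homotopy _ _ F L (fun X => k X \oc h X)).
- by move=> X; apply: gr_hom_iso.
- by move=> X Y f; rewrite -compA hcomp_nat compA hcomp_nat compA.
- by rewrite (hcomp_unit k) (hcomp_unit h) compA.
- move=> X Y; rewrite tensorm_comp compA -hcomp_mul -!compA.
  by rewrite hcomp_mul.
Qed.

Lemma homotopic_equivalence : RelationClasses.Equivalence (@homotopic C D).
Proof.
by split; [exact: homotopic_refl | exact: homotopic_sym | exact: homotopic_trans].
Qed.

End HomotopicEquiv.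

Section Dis.
Variable Pi : groupType.

(* A morphism x -> y is a proof of x = y, so the only morphisms are           *)
(* identities, and all morphism equations hold by proof irrelevance.          *)
Definition dis_hom (x y : Pi) : Type := x = y.

Lemma dis_hom_irr (x y : Pi) (f g : dis_hom x y) : f = g.
Proof. exact: (@Prop_irrelevance (x = y) f g). Qed.

Definition dis_category : category :=
  @Category Pi dis_hom (fun x => erefl x)
    (fun x y z yz xy => etrans xy yz)
    (fun _ _ _ _ _ _ _ => dis_hom_irr _ _)
    (fun _ _ _ => dis_hom_irr _ _)
    (fun _ _ _ => dis_hom_irr _ _).

Lemma dis_iso (x y : dis_category) (f : hom x y) : is_iso f.
Proof. by exists (esym f); split; apply: dis_hom_irr. Qed.

Definition dis_monoidal : monoidal_category :=
  @MonoidalCategory dis_category (1 : Pi) (@mul Pi)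
    (fun _ _ _ _ f g => f_equal2 (@mul Pi) f g)
    (@mulgA Pi) (@mul1g Pi) (@mulg1 Pi)
    (fun _ _ => dis_hom_irr _ _)
    (fun _ _ _ _ _ _ _ _ _ _ => dis_hom_irr _ _)
    (fun _ _ _ => dis_iso _) (fun _ => dis_iso _) (fun _ => dis_iso _)
    (fun _ _ _ _ _ _ _ _ _ => dis_hom_irr _ _)
    (fun _ _ _ => dis_hom_irr _ _)
    (fun _ _ _ => dis_hom_irr _ _)
    (fun _ _ _ _ => dis_hom_irr _ _)
    (fun _ _ => dis_hom_irr _ _).

Lemma dis_obj_inv (x : dis_monoidal) : exists y : dis_monoidal,
  (exists f : hom (x \ox y) unit_obj, is_iso f) /\
  (exists f : hom (y \ox x) unit_obj, is_iso f).
Proof.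
exists ((x : Pi)^-1); split.
  by exists (mulgV (x : Pi)); apply: dis_iso.
by exists (mulVg (x : Pi)); apply: dis_iso.
Qed.

Definition Dis : gr_category := @GrCategory dis_monoidal dis_iso dis_obj_inv.

End Dis.

Section AutCat.
Variable G : groupType.
Implicit Types s t u : aut G.

Definition aut_hom s t : Type := {c : G | s = inner c * t}.

Lemma aut_hom_ext s t (f g : aut_hom s t) : sval f = sval g -> f = g.
Proof. exact: eq_sig_hprop. Qed.

Lemma aut_id_subproof s : s = inner 1 * s.
Proof. by rewrite inner1 mul1g. Qed.

Definition aut_id s : aut_hom s s := exist _ 1 (aut_id_subproof s).

Lemma aut_comp_subproof s t u (d : aut_hom t u) (c : aut_hom s t) :
  s = inner (sval c * sval d) * u.
Proof. by case: c d => c /= -> [d /= ->]; rewrite innerM mulgA. Qed.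

Definition aut_comp s t u (d : aut_hom t u) (c : aut_hom s t) : aut_hom s u :=
  exist _ (sval c * sval d) (aut_comp_subproof d c).

Lemma aut_compA s t u v (h : aut_hom u v) (g : aut_hom t u) (f : aut_hom s t) :
  aut_comp h (aut_comp g f) = aut_comp (aut_comp h g) f.
Proof. by apply: aut_hom_ext => /=; rewrite mulgA. Qed.

Lemma aut_comp1m s t (f : aut_hom s t) : aut_comp (aut_id t) f = f.
Proof. by apply: aut_hom_ext; rewrite /= mulg1. Qed.

Lemma aut_compm1 s t (f : aut_hom s t) : aut_comp f (aut_id s) = f.
Proof. by apply: aut_hom_ext; rewrite /= mul1g. Qed.

Definition aut_category : category :=
  @Category (aut G) aut_hom aut_id aut_comp aut_compA aut_comp1m aut_compm1.

Lemma aut_iso (s t : aut_category) (f : hom s t) : is_iso f.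
Proof.
case: f => c st; have ts : t = inner c^-1 * s by rewrite st innerV mulKg.
exists (exist _ c^-1 ts).
by split; apply: aut_hom_ext; rewrite /= ?mulgV ?mulVg.
Qed.

Lemma aut_tensor_subproof s s' t t' (c : aut_hom s s') (d : aut_hom t t') :
  s * t = inner (sval c * s' (sval d)) * (s' * t').
Proof.
case: c d => c /= -> [d /= ->].
by rewrite innerM -!mulgA; congr (_ * _); rewrite !mulgA aut_inner.
Qed.

Definition aut_tensor s s' t t' (c : aut_hom s s') (d : aut_hom t t') :
    aut_hom (s * t) (s' * t') :=
  exist _ (sval c * s' (sval d)) (aut_tensor_subproof c d).

(* The constraints of a strict category are identities; as X (Y Z) and        *)
(* (X Y) Z are only propositionally equal, the identity between them is the   *)
(* morphism whose underlying element of G is 1.                               *)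
Definition aut_eqhom s t (e : s = t) : aut_hom s t :=
  exist _ 1 (etrans e (aut_id_subproof t)).

Lemma aut_tensor1 s t : aut_tensor (aut_id s) (aut_id t) = aut_id (s * t).
Proof. by apply: aut_hom_ext; rewrite /= aut1 mulg1. Qed.

Lemma aut_tensor_comp s s' s'' t t' t''
    (f' : aut_hom s' s'') (f : aut_hom s s')
    (g' : aut_hom t' t'') (g : aut_hom t t') :
  aut_tensor (aut_comp f' f) (aut_comp g' g)
    = aut_comp (aut_tensor f' g') (aut_tensor f g).
Proof.
apply: aut_hom_ext; case: f' => c /= s's''; rewrite {}s's'' in f *.
by rewrite !aut_mulE /= !autM !mulgA mulgVK.
Qed.

Lemma aut_assoc_nat s s' t t' u u'
    (f : aut_hom s s') (g : aut_hom t t') (h : aut_hom u u') :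
  aut_comp (aut_eqhom (mulgA s' t' u')) (aut_tensor f (aut_tensor g h))
    = aut_comp (aut_tensor (aut_tensor f g) h) (aut_eqhom (mulgA s t u)).
Proof. by apply: aut_hom_ext; rewrite /= mulg1 mul1g !autM !mulgA. Qed.

Lemma aut_lunit_nat s t (f : aut_hom s t) :
  aut_comp (aut_eqhom (mul1g t)) (aut_tensor (aut_id 1) f)
    = aut_comp f (aut_eqhom (mul1g s)).
Proof. by apply: aut_hom_ext; rewrite /= mulg1. Qed.

Lemma aut_runit_nat s t (f : aut_hom s t) :
  aut_comp (aut_eqhom (mulg1 t)) (aut_tensor f (aut_id 1))
    = aut_comp f (aut_eqhom (mulg1 s)).
Proof. by apply: aut_hom_ext; rewrite /= aut1 !mulg1 mul1g. Qed.

Lemma aut_pentagon s t u v :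
  aut_comp (aut_eqhom (mulgA (s * t) u v)) (aut_eqhom (mulgA s t (u * v)))
    = aut_comp (aut_comp (aut_tensor (aut_eqhom (mulgA s t u)) (aut_id v))
                         (aut_eqhom (mulgA s (t * u) v)))
               (aut_tensor (aut_id s) (aut_eqhom (mulgA t u v))).
Proof. by apply: aut_hom_ext; rewrite /= !aut1 !mulg1. Qed.

Lemma aut_triangle s t :
  aut_comp (aut_tensor (aut_eqhom (mulg1 s)) (aut_id t))
           (aut_eqhom (mulgA s 1 t))
    = aut_tensor (aut_id s) (aut_eqhom (mul1g t)).
Proof. by apply: aut_hom_ext; rewrite /= !aut1 !mulg1. Qed.

Definition aut_monoidal : monoidal_category :=
  @MonoidalCategory aut_category (1 : aut G) (@mul (aut G)) aut_tensor
    (fun s t u => aut_eqhom (mulgA s t u))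
    (fun s => aut_eqhom (mul1g s)) (fun s => aut_eqhom (mulg1 s))
    aut_tensor1 aut_tensor_comp
    (fun _ _ _ => aut_iso _) (fun _ => aut_iso _) (fun _ => aut_iso _)
    aut_assoc_nat aut_lunit_nat aut_runit_nat aut_pentagon aut_triangle.

Lemma aut_obj_inv (s : aut_monoidal) : exists t : aut_monoidal,
  (exists f : hom (s \ox t) unit_obj, is_iso f) /\
  (exists f : hom (t \ox s) unit_obj, is_iso f).
Proof.
exists ((s : aut G)^-1); split.
  by exists (aut_eqhom (mulgV (s : aut G))); apply: aut_iso.
by exists (aut_eqhom (mulVg (s : aut G))); apply: aut_iso.
Qed.

Definition AutCat : gr_category := @GrCategory aut_monoidal aut_iso aut_obj_inv.

End AutCat.

Record extension (Pi G : groupType) := Extension {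
  ext_mid :> groupType;
  ext_inj : {multiplicative G -> ext_mid};
  ext_proj : {multiplicative ext_mid -> Pi};
  ext_inj_inj : injective ext_inj;
  ext_proj_surj : forall x, exists b, ext_proj b = x;
  ext_exact : forall b, ext_proj b = 1 <-> exists a, ext_inj a = b }.

Arguments ext_inj {Pi G} e.
Arguments ext_proj {Pi G} e.

Definition congruent (Pi G : groupType) (E E' : extension Pi G) : Prop :=
  exists f : {multiplicative E -> E'},
    [/\ bijective f, f \o ext_inj E =1 ext_inj E'
      & ext_proj E' \o f =1 ext_proj E].

Section CongruentEquiv.
Variables Pi G : groupType.
Implicit Types E : extension Pi G.

Lemma congruent_refl E : congruent E E.
Proof. by exists idfun; split=> //; exists id. Qed.

Lemma congruent_sym E E' : congruent E E' -> congruent E' E.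
Proof.
move=> [f [[g fK gK] fi pf]].
pose gM := isMultiplicative.Build E' E g (can2_gmulfM fK gK).
pose g' : {multiplicative E' -> E} := HB.pack g gM.
exists g'; split=> [|a|b] /=; first by exists f.
  by have /= <- := fi a; apply: fK.
by have /= <- := pf (g b); rewrite gK.
Qed.

Lemma congruent_trans E E' E'' :
  congruent E E' -> congruent E' E'' -> congruent E E''.
Proof.
move=> [f [fB fi pf]] [g [gB gi pg]].
exists (g \o f); split=> [|a|b]; first exact: bij_comp.
  by have /= <- := gi a; have /= <- := fi a.
by have /= <- := pf b; have /= <- := pg (f b).
Qed.

Lemma congruent_equivalence : RelationClasses.Equivalence (@congruent Pi G).
Proof.
by split; [exact: congruent_refl | exact: congruent_sym | exact: congruent_trans].
Qed.

End CongruentEquiv.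

Section ExtOuter.
Variables (Pi G : groupType) (E : extension Pi G).
Local Notation i := (ext_inj E).
Local Notation p := (ext_proj E).

Lemma ext_conj_ex (b : E) :
  exists s : aut G, forall a, i (s a) = b * i a * b^-1.
Proof.
have normal (c : E) a : exists a', i a' = c * i a * c^-1.
  apply/ext_exact; rewrite !gmulfM.
  have -> : p (i a) = 1 by apply/ext_exact; exists a.
  by rewrite mulg1 -gmulfM mulgV multiplicative1.
pose f c a := sval (cid (normal c a)).
have fE c a : i (f c a) = c * i a * c^-1 by rewrite /f; case: cid.
have fM : {morph f b : a a' / a * a'}.
  move=> a a'; apply: (@ext_inj_inj _ _ E).
  by rewrite gmulfM !fE gmulfM !mulgA mulgVK.
have fK c : cancel (f c) (f c^-1).
  move=> a; apply: (@ext_inj_inj _ _ E).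
  by rewrite !fE invgK !mulgA mulVg mul1g mulgVK.
have fVK : cancel (f b^-1) (f b) by move=> a; rewrite -{1}[b]invgK fK.
by exists (Aut fM (Bijective (fK b) fVK)) => a /=; apply: fE.
Qed.

Definition ext_conj (b : E) : aut G := sval (cid (ext_conj_ex b)).

Lemma ext_conjE b a : i (ext_conj b a) = b * i a * b^-1.
Proof. by rewrite /ext_conj; case: cid. Qed.

Lemma ext_conjM b c : ext_conj (b * c) = ext_conj b * ext_conj c.
Proof.
apply: aut_ext => a; apply: (@ext_inj_inj _ _ E).
by rewrite aut_mulE !ext_conjE invgM !mulgA.
Qed.

Lemma ext_conj_inj a : ext_conj (i a) = inner a.
Proof.
apply: aut_ext => a'; apply: (@ext_inj_inj _ _ E).
rewrite ext_conjE /= !gmulfM; congr (_ * _).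
by apply: (mulgI (i a)); rewrite mulgV -gmulfM mulgV multiplicative1.
Qed.

(* The induced homomorphism Pi -> Out G: lift to the middle group, then       *)
(* conjugate; by [ext_outer_proj] the lift does not matter.                   *)
Definition ext_outer (x : Pi) : Out G :=
  out_class (ext_conj (sval (cid (ext_proj_surj E x)))).

Lemma ext_outer_proj b : ext_outer (p b) = out_class (ext_conj b).
Proof.
rewrite /ext_outer; case: cid => c /= cb.
have /ext_exact[a ac] : p (c * b^-1) = 1.
  by rewrite gmulfM cb -gmulfM mulgV multiplicative1.
by apply/out_classP; exists a; rewrite -ext_conj_inj -ext_conjM ac mulgVK.
Qed.

Lemma ext_outerM : {morph ext_outer : x y / x * y}.
Proof.
move=> x y; have [b <-] := ext_proj_surj E x; have [c <-] := ext_proj_surj E y.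
by rewrite -gmulfM !ext_outer_proj ext_conjM gmulfM.
Qed.

HB.instance Definition _ := isMultiplicative.Build Pi (Out G) ext_outer ext_outerM.

End ExtOuter.

(* The set of equivalence classes of R, as predicates.  A MathComp quotient   *)
(* would require a choiceType, but [extension Pi G] lives in a larger         *)
(* universe than its middle groups.                                           *)
Definition eq_classes (T : Type) (R : T -> T -> Prop) : Type :=
  {C : T -> Prop | exists x, C = R x}.

Section HomExt.
Variables (Pi G : groupType) (psi : {multiplicative Pi -> Out G}).

(* The pi_0 part of "F induces (psi, 0)": objects of Dis Pi are isomorphic    *)
(* only when equal, and isomorphism classes in AutCat G are elements of Out G *)
(* (out_classP).  The pi_1 part is void, since pi_1 of Dis Pi is trivial.     *)
Definition functor_induces (F : gr_functor (Dis Pi) (AutCat G)) : Prop :=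
  forall x : Pi, out_class (F x) = psi x.

Definition Hom_psi : Type :=
  eq_classes (fun F K : {F | functor_induces F} => homotopic (sval F) (sval K)).

Definition extension_induces (E : extension Pi G) : Prop := ext_outer E =1 psi.

Definition Ext_psi : Type :=
  eq_classes (fun E E' : {E | extension_induces E} =>
             congruent (sval E) (sval E')).

End HomExt.

(* Main.v *)
(* A Gr-functor F : Dis Pi -> Aut_G is the same thing as a Schreier factor    *)
(* system: automorphisms F x of G, elements f x y of G with                   *)
(* F x (F y) = inner (f x y) (F (x y)) coming from the monoidal structure,    *)
(* and a unit c coming from F_*; coherence of F is exactly the associativity  *)
(* and unit laws of the twisted product on G * Pi, an extension of Pi by G.   *)
(* A homotopy given by g x : F x -> K x corresponds to the congruence         *)
(* (a, x) |-> (a g x, x), and every extension arises from the factor system   *)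
(* of a set-theoretic section of its projection.                              *)
Require Import Defs.
From HB Require Import structures.
From mathcomp Require Import all_boot.
From mathcomp Require Import boolp.

Set Implicit Arguments.
Unset Strict Implicit.
Unset Printing Implicit Defensive.

Local Open Scope group_scope.

(** Both sides are governed by the same data: unnormalized factor systems up to [fs_homotopic]. A
    Gr-functor is read as a factor system by [gr_fs], which is onto ([gr_fs_surj]). The twisted
    product [fs_ext] turns a factor system into an extension, and a set-theoretic section shows that
    every extension arises up to congruence ([fs_ext_fs]). Homotopy and congruence both translate
    into [fs_homotopic] ([homotopicP], [fs_homotopicP]), and [ext_outer_fs] matches the two
    conditions on [psi]. So sending F to [fs_ext (gr_fs F)] preserves and reflects the two relations
    and is onto up to congruence; [eq_classes_bijective] then gives the bijection of classes. *)

(** * Bijections between sets of equivalence classes *)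

Lemma inj_surj_bijective (A B : Type) (f : A -> B) :
  injective f -> (forall b, exists a, f a = b) -> bijective f.
Proof.
move=> fI fS; pose g b := sval (cid (fS b)).
have gK : cancel g f by move=> b; rewrite /g; case: cid.
by exists g => // a; apply: fI; rewrite gK.
Qed.

Lemma left_inverse_right_inverse (T : Type) (e : T) inv (op : T -> T -> T) :
  associative op -> left_id e op -> left_inverse e inv op ->
  right_inverse e inv op.
Proof.
move=> opA op1 opV x; rewrite -[LHS]op1 -{1}(opV (inv x)) -opA.
by rewrite [X in op _ X]opA opV op1 opV.
Qed.

(** Preserving the relation makes [f] well defined on classes, reflecting it makes the induced map
    injective, and the last hypothesis makes it surjective. *)
Lemma eq_classes_bijective (T U : Type) (R : T -> T -> Prop)
    (S : U -> U -> Prop) (f : T -> U) :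
    RelationClasses.Equivalence R -> RelationClasses.Equivalence S ->
    (forall x y, R x y <-> S (f x) (f y)) ->
    (forall u, exists x, S (f x) u) ->
  exists h : eq_classes R -> eq_classes S, bijective h.
Proof.
move=> [Rr Rs Rt] [Sr Ss St] fRS fS.
have RE x y : R x y -> R x = R y.
  by move=> xy; apply/funext => z; apply/propext; split; [apply/Rt/Rs|apply: Rt].
have SE u v : S u v -> S u = S v.
  by move=> uv; apply/funext => z; apply/propext; split; [apply/St/Ss|apply: St].
(* A class is a predicate, so [h] has to act through a chosen representative. *)
pose rep (C : eq_classes R) := sval (cid (svalP C)).
have repE C : sval C = R (rep C) by rewrite /rep; case: cid.
pose h C : eq_classes S := exist _ (S (f (rep C))) (ex_intro _ (f (rep C)) erefl).
exists h; apply: inj_surj_bijective => [C C' /(congr1 sval) /= e | [D [u Du]]].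
  apply: eq_sig_hprop => [? ? ?|]; first exact: Prop_irrelevance.
  by rewrite !repE; apply/RE/fRS; rewrite e; apply: Sr.
have [x xu] := fS u; pose C : eq_classes R := exist _ (R x) (ex_intro _ x erefl).
exists C; apply: eq_sig_hprop => [? ? ?|/=]; first exact: Prop_irrelevance.
rewrite Du -(SE _ _ xu); apply/SE/fRS.
by rewrite -(repE C); apply: Rr.
Qed.

(** * Morphisms of extensions *)

Section ExtensionMorphism.
Variables Pi G : groupType.
Implicit Types E : extension Pi G.

Lemma ext_proj_inj E a : ext_proj E (ext_inj E a) = 1.
Proof. by apply/ext_exact; exists a. Qed.

Lemma ext_proj_eq E (b c : E) :
  ext_proj E b = ext_proj E c -> exists a, b = ext_inj E a * c.
Proof.
move=> bc; have /ext_exact[a ab] : ext_proj E (b * c^-1) = 1.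
  by rewrite gmulfM bc -gmulfM mulgV multiplicative1.
by exists a; rewrite ab mulgVK.
Qed.

(* The short five lemma. *)
Lemma ext_morphism_congruent E E' (f : E -> E') :
    {morph f : b c / b * c} -> (forall a, f (ext_inj E a) = ext_inj E' a) ->
    (forall b, ext_proj E' (f b) = ext_proj E b) ->
  congruent E E'.
Proof.
move=> fM fi pf; pose m := isMultiplicative.Build E E' f fM.
pose f' : {multiplicative E -> E'} := HB.pack f m.
exists f'; split=> //; apply: inj_surj_bijective => [b c /= fbc | b'].
  have [a ac] : exists a, b = ext_inj E a * c.
    by apply: ext_proj_eq; rewrite -!pf fbc.
  have a1 : ext_inj E' a = 1.
    by apply: (mulIg (f c)); rewrite mul1g -fi -fM -ac.
  by rewrite ac -[RHS]mul1g -(multiplicative1 (ext_inj E)); congr (ext_inj E _ * _);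
    apply: (@ext_inj_inj _ _ E'); rewrite a1 multiplicative1.
have [b bb'] := ext_proj_surj E (ext_proj E' b').
have [a ->] : exists a, b' = ext_inj E' a * f b.
  by apply: ext_proj_eq; rewrite pf bb'.
by exists (ext_inj E a * b); rewrite /= fM fi.
Qed.

End ExtensionMorphism.

(** * Factor systems and their twisted products *)

Section FactorSystem.
Variables Pi G : groupType.

(** A nonabelian 2-cocycle, not normalized: [act 1] is conjugation by the inverse of [un], and
    [coc 1 1] is the inverse of [un]. The element [un] records the unit constraint of a
    Gr-functor. *)
Record factor_system := FactorSystem {
  act : Pi -> aut G;
  coc : Pi -> Pi -> G;
  un : G;
  act_mul : forall x y, act x * act y = inner (coc x y) * act (x * y);
  act_un : 1 = inner un * act 1;
  coc_assoc : forall x y z,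
    act x (coc y z) * coc x (y * z) = coc x y * coc (x * y) z;
  coc_lunit : forall x, un * coc 1 x = 1;
  coc_runit : forall x, act x un * coc x 1 = 1 }.

Implicit Types S : factor_system.

Lemma factor_system_eq S S' :
  act S = act S' -> coc S = coc S' -> un S = un S' -> S = S'.
Proof.
case: S S' => a c u ? ? ? ? ? [a' c' u' ? ? ? ? ?] /= aa' cc' uu'.
by subst a' c' u'; congr FactorSystem; apply: Prop_irrelevance.
Qed.

Lemma act_mulE S x y a :
  act S x (act S y a) * coc S x y = coc S x y * act S (x * y) a.
Proof. by rewrite -aut_mulE act_mul aut_mulE /= mulgVK. Qed.

Lemma un_actE S a : un S * act S 1 a = a * un S.
Proof. by rewrite -[in RHS](aut_oneE a) (act_un S) aut_mulE /= mulgVK. Qed.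

(** The type is indexed by [S] so that each factor system puts its own group structure on the same
    product. *)
Definition fs_mid S : Type := (G * Pi)%type.
HB.instance Definition _ S := Choice.copy (fs_mid S) (G * Pi)%type.

(** The pair [(a, x)] stands for [i a * s x], with [s] a section of the extension; the formula is
    the product of two such elements, moved back to this form. *)
Definition fs_mul S (b c : fs_mid S) : fs_mid S :=
  (b.1 * act S b.2 c.1 * coc S b.2 c.2, b.2 * c.2).
Definition fs_one S : fs_mid S := (un S, 1).
Definition fs_inv S (b : fs_mid S) : fs_mid S :=
  (un S * (act S b.2^-1 b.1 * coc S b.2^-1 b.2)^-1, b.2^-1).

(** The cocycle identity matches the values of [coc], and [act_mulE] moves the twisted third factor
    past [coc x y]. *)
Lemma fs_mulA S : associative (@fs_mul S).
Proof.
move=> [a x] [b y] [c z]; congr (_, _) => /=; last exact: mulgA.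
by rewrite !autM -!mulgA coc_assoc; do 2 congr (_ * _); rewrite !mulgA act_mulE.
Qed.

Lemma fs_mul1 S : left_id (fs_one S) (@fs_mul S).
Proof.
move=> [a x]; congr (_, _) => /=; last exact: mul1g.
by rewrite un_actE -mulgA coc_lunit mulg1.
Qed.

Lemma fs_mulr1 S : right_id (fs_one S) (@fs_mul S).
Proof.
move=> [a x]; congr (_, _) => /=; last exact: mulg1.
by rewrite -mulgA coc_runit mulg1.
Qed.

Lemma fs_mulV S : left_inverse (fs_one S) (@fs_inv S) (@fs_mul S).
Proof.
by move=> [a x]; congr (_, _) => /=; rewrite -?mulgA ?mulVg ?mulg1.
Qed.

HB.instance Definition _ S := isGroup.Build (fs_mid S)
  (@fs_mulA S) (@fs_mul1 S) (@fs_mulr1 S) (@fs_mulV S)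
  (left_inverse_right_inverse (@fs_mulA S) (@fs_mul1 S) (@fs_mulV S)).

Lemma fs_midM S (b c : fs_mid S) :
  b * c = (b.1 * act S b.2 c.1 * coc S b.2 c.2, b.2 * c.2).
Proof. by []. Qed.

(** The factor [un] appears because the unit is [(un, 1)]; it cancels in [fs_inj_mul]. *)
Definition fs_inj S (a : G) : fs_mid S := (a * un S, 1).
Definition fs_proj S (b : fs_mid S) : Pi := b.2.

Lemma fs_inj_mul S a (b : fs_mid S) : fs_inj S a * b = (a * b.1, b.2).
Proof.
case: b => b x; rewrite fs_midM /= mul1g -!(mulgA a) un_actE.
by rewrite -mulgA coc_lunit mulg1.
Qed.

Lemma fs_injM S : {morph fs_inj S : a b / a * b}.
Proof. by move=> a b; rewrite fs_inj_mul /= mulgA. Qed.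

HB.instance Definition _ S := isMultiplicative.Build G (fs_mid S) (fs_inj S)
  (@fs_injM S).
HB.instance Definition _ S := isMultiplicative.Build (fs_mid S) Pi (@fs_proj S)
  (fun _ _ => erefl).

Lemma fs_inj_inj S : injective (fs_inj S).
Proof. by move=> a b [] /mulIg. Qed.

Lemma fs_proj_surj S x : exists b, @fs_proj S b = x.
Proof. by exists (1, x). Qed.

Lemma fs_exact S b : fs_proj b = 1 <-> exists a, fs_inj S a = b.
Proof.
case: b => b x; split=> [/= -> | [a [_ <-]]] //.
by exists (b * (un S)^-1); rewrite /fs_inj mulgVK.
Qed.

Definition fs_ext S : extension Pi G :=
  @Extension Pi G (fs_mid S) (fs_inj S) (@fs_proj S)
    (@fs_inj_inj S) (@fs_proj_surj S) (@fs_exact S).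

Lemma fs_section_inj S x a :
  ((1, x) : fs_mid S) * fs_inj S a = (act S x a, x).
Proof. by rewrite fs_midM /= mul1g autM mulg1 -mulgA coc_runit mulg1. Qed.

(** Both [(1, x) * fs_inj S a] and [fs_inj S (act S x a) * (1, x)] equal [(act S x a, x)]. *)
Lemma ext_conj_fs S x : ext_conj ((1, x) : fs_ext S) = act S x.
Proof.
apply: aut_ext => a; apply: (@ext_inj_inj _ _ (fs_ext S)).
rewrite ext_conjE; apply: (mulIg ((1, x) : fs_mid S)).
by rewrite mulgVK /= fs_section_inj fs_inj_mul mulg1.
Qed.

Lemma ext_outer_fs S x : ext_outer (fs_ext S) x = out_class (act S x).
Proof. by rewrite -ext_conj_fs -ext_outer_proj. Qed.

(** The first condition makes [g x] a morphism of [AutCat G]; the others are compatibility with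
    units and tensor products. For extensions, [g] measures a change of section. *)
Definition fs_homotopic S S' := exists g : Pi -> G,
  [/\ forall x, act S x = inner (g x) * act S' x, un S' = un S * g 1 &
    forall x y, coc S x y * g (x * y) = g x * act S' x (g y) * coc S' x y].

(** A congruence fixes G and lies over [Pi], so it sends [(1, x)] to some [(g x, x)] and is
    determined by [g]. Its multiplicativity on [(1, x) * fs_inj S a] and on [(1, x) * (1, y)], and
    its value at the unit, are the three conditions on [g]. *)
Lemma fs_homotopicP S S' :
  fs_homotopic S S' <-> congruent (fs_ext S) (fs_ext S').
Proof.
split=> [[g [gact gun gcoc]] | [f [_ fi pf]]].
  pose f (b : fs_ext S) : fs_ext S' := (b.1 * g b.2, b.2).
  apply: (@ext_morphism_congruent _ _ _ _ f) => //= [[a x] [b y]|a].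
    rewrite /f !fs_midM /=; congr (_, _).
    rewrite autM gact aut_mulE /= -!mulgA gcoc.
    by rewrite !mulgA mulgVK.
  by rewrite /f /fs_inj /= gun mulgA.
have fM (b c : fs_mid S) : f (b * c) = f b * f c :> fs_mid S'.
  exact: (@gmulfM (fs_ext S) (fs_ext S')).
pose g x := (f (1, x)).1.
have f1E x : f (1, x) = (g x, x) :> fs_mid S'.
  by have := pf (1, x); rewrite /g /=; case: (f _) => b y /= <-.
have fE a x : f (a, x) = (a * g x, x) :> fs_mid S'.
  have -> : ((a, x) : fs_mid S) = fs_inj S a * (1, x).
    by rewrite fs_inj_mul mulg1.
  by rewrite fM f1E; have /= -> := fi a; rewrite fs_inj_mul.
exists g; split=> [x | | x y].
- apply: aut_ext => a; rewrite aut_mulE /=; apply: (mulIg (g x)).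
  rewrite mulgVK.
  have := fM (1, x) (fs_inj S a); rewrite fs_section_inj fE f1E.
  have /= -> := fi a; rewrite fs_midM /= => -[-> _].
  by rewrite autM -!mulgA coc_runit mulg1.
- by have := multiplicative1 f; rewrite (fE (un S) 1) => -[].
- have := fM (1, x) (1, y).
  by rewrite fs_midM /= aut1 !mul1g fE !f1E fs_midM => -[].
Qed.

End FactorSystem.

(** * The factor system of a section of an extension *)

Section SectionFactorSystem.
Variables (Pi G : groupType) (E : extension Pi G).
Local Notation i := (ext_inj E).

(** Chosen without normalization: [ext_section 1] need not be 1, and [ext_un] corrects for this. *)
Definition ext_section x : E := sval (cid (ext_proj_surj E x)).

Lemma ext_sectionK x : ext_proj E (ext_section x) = x.
Proof. by rewrite /ext_section; case: cid. Qed.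

Lemma ext_section_mul_ex x y :
  exists a, ext_section x * ext_section y = i a * ext_section (x * y).
Proof. by apply: ext_proj_eq; rewrite gmulfM !ext_sectionK. Qed.

Lemma ext_section1_ex : exists a, 1 = i a * ext_section 1.
Proof. by apply: ext_proj_eq; rewrite multiplicative1 ext_sectionK. Qed.

Definition ext_coc x y : G := sval (cid (ext_section_mul_ex x y)).
Definition ext_un : G := sval (cid ext_section1_ex).

Lemma ext_section_mul x y :
  ext_section x * ext_section y = i (ext_coc x y) * ext_section (x * y).
Proof. by rewrite /ext_coc; case: cid. Qed.

Lemma ext_section1 : i ext_un * ext_section 1 = 1.
Proof. by rewrite /ext_un; case: cid. Qed.

Lemma ext_conj_comm (b : E) a : i (ext_conj b a) * b = b * i a.
Proof. by rewrite ext_conjE mulgVK. Qed.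

(** Identities in G are proved in E, after multiplying by a value of the section. *)
Let inj_section a a' x :
  i a * ext_section x = i a' * ext_section x -> a = a'.
Proof. by move=> /mulIg /ext_inj_inj. Qed.

Lemma ext_act_mul x y : ext_conj (ext_section x) * ext_conj (ext_section y)
  = inner (ext_coc x y) * ext_conj (ext_section (x * y)).
Proof. by rewrite -ext_conjM ext_section_mul ext_conjM (ext_conj_inj E). Qed.

Lemma ext_conj1 : ext_conj (1 : E) = 1.
Proof. by rewrite -(multiplicative1 i) (ext_conj_inj E) inner1. Qed.

Lemma ext_act_un : 1 = inner ext_un * ext_conj (ext_section 1).
Proof. by rewrite -(ext_conj_inj E) -ext_conjM ext_section1 ext_conj1. Qed.

(** The product of the section values at [x], [y], [z] is expanded in E with both bracketings. The
    unit laws below likewise come from multiplying a section value by 1. *)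
Lemma ext_coc_assoc x y z :
  ext_conj (ext_section x) (ext_coc y z) * ext_coc x (y * z)
  = ext_coc x y * ext_coc (x * y) z.
Proof.
apply: (@inj_section _ _ (x * (y * z))); rewrite !gmulfM -!mulgA.
rewrite -ext_section_mul (mulgA x) -ext_section_mul mulgA ext_conj_comm -mulgA.
by rewrite -ext_section_mul !mulgA ext_section_mul.
Qed.

Lemma ext_coc_lunit x : ext_un * ext_coc 1 x = 1.
Proof.
apply: (@inj_section _ _ x); rewrite gmulfM -mulgA -{2}(mul1g x).
by rewrite -ext_section_mul mulgA ext_section1 multiplicative1.
Qed.

Lemma ext_coc_runit x : ext_conj (ext_section x) ext_un * ext_coc x 1 = 1.
Proof.
apply: (@inj_section _ _ x); rewrite gmulfM -mulgA -{3}(mulg1 x).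
rewrite -ext_section_mul mulgA ext_conj_comm -mulgA ext_section1 mulg1.
by rewrite multiplicative1 mul1g.
Qed.

Definition ext_fs : factor_system Pi G :=
  FactorSystem ext_act_mul ext_act_un ext_coc_assoc ext_coc_lunit ext_coc_runit.

(** Every element of E has the form [i a * ext_section x], and the twisted product encodes how such
    elements multiply. *)
Lemma fs_ext_fs : congruent (fs_ext ext_fs) E.
Proof.
pose f (b : fs_ext ext_fs) : E := i b.1 * ext_section b.2.
apply: (@ext_morphism_congruent _ _ _ _ f) => [[a x] [b y]|a|[a x]].
- rewrite /f /= !gmulfM -!mulgA -ext_section_mul; congr (_ * _).
  by rewrite !mulgA ext_conj_comm.
- by rewrite /f /= gmulfM -mulgA ext_section1 mulg1.
- by rewrite /f /= gmulfM ext_proj_inj mul1g ext_sectionK.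
Qed.

End SectionFactorSystem.

(** * Gr-functors as factor systems *)

Section GrFunctor.
Variables Pi G : groupType.
Implicit Types F : gr_functor (Dis Pi) (AutCat G).

(** A morphism of [Dis Pi] is an equality; eliminating it leaves an identity, which the functor
    preserves. *)
Lemma fmap_disE F (x y : Dis Pi) (e : hom x y) : sval (fmap F e) = 1.
Proof.
case: y / e; have := fmap1 F x.
by move=> /(congr1 sval) /= <-.
Qed.

Section FactorSystemOf.
Variable F : gr_functor (Dis Pi) (AutCat G).

Definition gr_act (x : Pi) : aut G := F x.
Definition gr_coc (x y : Pi) : G := sval (fmul F x y).
Definition gr_un : G := sval (funit F).

(** A morphism of [AutCat G] carries the proof that its element conjugates target into source; that
    proof is the equation. *)
Lemma gr_act_mul x y :
  gr_act x * gr_act y = inner (gr_coc x y) * gr_act (x * y).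
Proof. exact: (svalP (fmul F x y)). Qed.

Lemma gr_act_un : 1 = inner gr_un * gr_act 1.
Proof. exact: (svalP (funit F)). Qed.

(** The constraints of [AutCat G] and the images of morphisms of [Dis Pi] have underlying element 1,
    so the coherence axioms of F reduce to the cocycle and unit laws. *)
Lemma gr_coc_assoc x y z : gr_act x (gr_coc y z) * gr_coc x (y * z)
  = gr_coc x y * gr_coc (x * y) z.
Proof.
have /(congr1 sval) := fmul_assoc F x y z.
by rewrite /= fmap_disE mulg1 !mul1g aut1 mulg1.
Qed.

Lemma gr_coc_lunit x : gr_un * gr_coc 1 x = 1.
Proof.
have /(congr1 sval) := fmul_lunit F x.
by rewrite /= fmap_disE aut1 !mulg1.
Qed.

Lemma gr_coc_runit x : gr_act x gr_un * gr_coc x 1 = 1.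
Proof.
have /(congr1 sval) := fmul_runit F x.
by rewrite /= fmap_disE mul1g mulg1.
Qed.

Definition gr_fs : factor_system Pi G :=
  FactorSystem gr_act_mul gr_act_un gr_coc_assoc gr_coc_lunit gr_coc_runit.

End FactorSystemOf.

(** Since [Dis Pi] has only identities, naturality is automatic and a homotopy is just the family of
    its underlying elements. *)
Lemma homotopicP F K : homotopic F K <-> fs_homotopic (gr_fs F) (gr_fs K).
Proof.
split=> [[h]|[g [gact gun gcoc]]].
  exists (fun x => sval (h x)); split=> [x | | x y] /=.
  - exact: (svalP (h x)).
  - exact: (congr1 sval (hcomp_unit h)).
  - exact: (congr1 sval (hcomp_mul h x y)).
constructor.
apply: (@Homotopy _ _ F K (fun x => exist _ (g x) (gact x) : hom (F x) (K x))).
- by move=> x; apply: gr_hom_iso.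
- move=> x y f; apply: aut_hom_ext; rewrite /= !fmap_disE.
  by case: y / f; rewrite mul1g mulg1.
- exact: aut_hom_ext.
- by move=> x y; apply: aut_hom_ext; apply: gcoc.
Qed.

Variable S : factor_system Pi G.

Definition fs_fmap (x y : Dis Pi) (e : hom x y) :
  @hom (AutCat G) (act S x) (act S y) := aut_eqhom (congr1 (act S) e).

Lemma fs_fmap_comp (x y z : Dis Pi) (g : hom y z) (f : hom x y) :
  fs_fmap (g \oc f) = fs_fmap g \oc fs_fmap f.
Proof. by apply: aut_hom_ext; rewrite /= mulg1. Qed.

Definition fs_functor : functor (Dis Pi) (AutCat G) :=
  @Functor (Dis Pi) (AutCat G) (act S) fs_fmap
    (fun _ => aut_hom_ext (erefl : sval (fs_fmap _) = sval (aut_id _)))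
    fs_fmap_comp.

(** The reading of the axioms in G is reversible: [coc] and [un] serve as the structure morphisms,
    invertible because every morphism of [AutCat G] is. *)
Lemma gr_fs_surj : exists F, gr_fs F = S.
Proof.
pose fmulS (x y : Dis Pi) :
    hom (fs_functor x \ox fs_functor y) (fs_functor (x \ox y)) :=
  exist _ (coc S x y) (act_mul S x y).
pose funitS : hom unit_obj (fs_functor unit_obj) := exist _ (un S) (act_un S).
have F_mul x y : is_iso (fmulS x y) by apply: gr_hom_iso.
have F_unit : is_iso funitS by apply: gr_hom_iso.
unshelve eexists (@MonoidalFunctor _ _ fs_functor fmulS funitS F_mul F_unit _ _ _ _).
- move=> x x' y y' f g; apply: aut_hom_ext.
  by case: x' / f; case: y' / g; rewrite /= aut1 !mulg1 mul1g.
- move=> x y z; apply: aut_hom_ext.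
  by rewrite /= aut1 !mulg1 !mul1g coc_assoc.
- by move=> x; apply: aut_hom_ext; rewrite /= aut1 !mulg1 coc_lunit.
- by move=> x; apply: aut_hom_ext; rewrite /= mulg1 mul1g coc_runit.
exact: factor_system_eq.
Qed.

End GrFunctor.

(** * The bijection on classes *)

Theorem theorem6p2 (Pi G : groupType) (psi : {multiplicative Pi -> Out G}) :
  exists Delta : Hom_psi psi -> Ext_psi psi, bijective Delta.
Proof.
have ind (F : {F | functor_induces psi F}) :
    extension_induces psi (fs_ext (gr_fs (sval F))).
  by move=> x; rewrite ext_outer_fs; apply: (svalP F).
pose D F : {E | extension_induces psi E} := exist _ _ (ind F).
apply: (@eq_classes_bijective _ _ _ _ D).
- have [r s t] := homotopic_equivalence (Dis Pi) (AutCat G).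
  by split=> [F|F K|F K L]; [apply: r | apply: s | apply: t].
- have [r s t] := congruent_equivalence Pi G.
  by split=> [E|E E'|E E' E'']; [apply: r | apply: s | apply: t].
- by move=> F K; rewrite homotopicP; apply: fs_homotopicP.
move=> [E Epsi]; have [F FE] := gr_fs_surj (ext_fs E).
(* [F x] is conjugation by [ext_section E x], an element over [x], so its outer class is the one
   induced by E. *)
have Fpsi : functor_induces psi F.
  move=> x; rewrite -Epsi -[x in RHS](ext_sectionK E) ext_outer_proj.
  by rewrite -[LHS]/(out_class (act (gr_fs F) x)) FE.
by exists (exist _ F Fpsi); rewrite /= FE; apply: fs_ext_fs.
Qed.
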